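(* Let $X$ be a perfect Polish space, $T$ a minimal homeomorphism of $X$, $G$ a Polish group, and $f:X\to G$ a continuous recurrent cocycle. Then there exists a $T$-invariant dense $G_\delta$-set $X_0\subset X$ such that for every $x\in X_0$ one has $$E_x(f)=P_x(f)=G_{\phi(x,e)},$$ where $E_x(f)$ is the local essential range of $f$ at $x$, $P_x(f)=\{g\in G:(x,g)\in\overline{T_f^{\mathbb Z}(x,e)}\}$, and $G_{\phi(x,e)}$ is the stabilizer of the point $\phi(x,e)$ under the generic Mackey action $W_f(G)$ associated with $f$.
   Context: $T$ minimal means that every $T$-orbit is dense in $X$. A continuous map $f:X\to G$ defines a $\mathbb Z$-cocycle by $f(n,x)=f(T^{n-1}x)\cdots f(Tx)f(x)$ for $n\ge 1$, $f(0,x)=e$ (the identity of $G$), and $f(n,x)=f(-n,T^nx)^{-1}$ for $n<0$. The skew product is the $\mathbb Z$-action on $X\times G$ given by $T_f^n(x,g)=(T^nx,f(n,x)g)$. The cocycle $f$ is recurrent if for every nonempty open $O\subset X\times G$ there is an integer $n\ne0$ with $T_f^nO\cap O\neq\varnothing$. Local essential range: $g\in E_x(f)$ iff for every open neighborhood $U$ of $g$ in $G$ and every open neighborhood $O$ of $x$ in $X$ there exists $n\neq 0$ such that $O\cap T^{-n}O\cap\{y\in X: f(n,y)\in U\}$ is nonempty. Generic Mackey action: let $\widetilde{\mathcal R}_{T_f}$ be the equivalence relation on $X\times G$ under which two points are equivalent iff their $T_f$-orbits have the same closure. Let $\Omega=(X\times G)/\widetilde{\mathcal R}_{T_f}$ be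 the quotient space and $\phi:X\times G\to\Omega$ the quotient map. Put $V(g)(x,h)=(x,hg^{-1})$ for $g\in G$; $V$ commutes with $T_f$. The generic Mackey action $W_f(G)$ of $G$ on $\Omega$ is $W_f(g)\omega=\phi(V(g)y)$ for any $y\in\phi^{-1}(\omega)$. For $\omega\in\Omega$, $G_\omega=\{g\in G:W_f(g)\omega=\omega\}$. *)

(* Defs.v *)
From HB Require Import structures.
From mathcomp Require Import all_boot all_order all_algebra generic_quotient.
From mathcomp Require Import all_classical all_reals all_analysis.

Set Implicit Arguments.
Unset Strict Implicit.
Unset Printing Implicit Defensive.

Import GRing.Theory.

Local Open Scope classical_set_scope.
Local Open Scope quotient_scope.
Local Open Scope group_scope.

(* Groups are written multiplicatively and need not be commutative, so
   topologicalZmodType does not apply. *)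
HB.mixin Record isTopologicalGroup G & Topological G & Group G := {
  mulg_continuous : continuous (fun x : G * G => x.1 * x.2) ;
  invg_continuous : continuous (fun x : G => x^-1)
}.

#[short(type="topologicalGroupType")]
HB.structure Definition TopologicalGroup :=
  {G of Topological G & Group G & isTopologicalGroup G}.

Record homeomorphism (X Y : topologicalType) := Homeomorphism {
  homeo_fun :> X -> Y ;
  homeo_inv : Y -> X ;
  homeo_funK : cancel homeo_fun homeo_inv ;
  homeo_invK : cancel homeo_inv homeo_fun ;
  homeo_fun_continuous : continuous homeo_fun ;
  homeo_inv_continuous : continuous homeo_inv
}.

Definition separable_space (X : topologicalType) :=
  exists2 D : set X, countable D & dense D.

Definition complete_metric (R : realType) (M : metricType R) :=
  forall u : nat -> M, cauchy (u @ \oo) -> exists l : M, u @ \oo --> l.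

Definition completely_metrizable (R : realType) (X : topologicalType) :=
  exists2 M : metricType R, complete_metric M & inhabited (homeomorphism X M).

Definition polish (R : realType) (X : topologicalType) :=
  separable_space X /\ completely_metrizable R X.

Section Dynamics.
Context {X : topologicalType} (T : homeomorphism X X).

Definition iterz (n : int) (x : X) : X :=
  match n with
  | Posz k => iter k T x
  | Negz k => iter k.+1 (homeo_inv T) x
  end.

Definition minimal := forall x : X, dense (range (iterz^~ x)).

End Dynamics.

Section Cocycle.
Context {X : topologicalType} {G : topologicalGroupType}.
Variables (T : homeomorphism X X) (f : X -> G).

Fixpoint cocycle_nat (k : nat) (x : X) : G :=
  if k is k'.+1 then f (iter k' T x) * cocycle_nat k' x else 1.

(* Negz k is the integer -(k + 1). *)
Definition cocycle (n : int) (x : X) : G :=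
  match n with
  | Posz k => cocycle_nat k x
  | Negz k => (cocycle_nat k.+1 (iterz T n x))^-1
  end.

Definition skew_product (n : int) (p : X * G) : X * G :=
  (iterz T n p.1, cocycle n p.1 * p.2).

Definition skew_orbit (p : X * G) : set (X * G) := range (skew_product^~ p).

Definition recurrent :=
  forall O : set (X * G), open O -> O !=set0 ->
  exists2 n : int, n != 0%R & (skew_product n @` O) `&` O !=set0.

Definition local_essential_range (x : X) : set G :=
  [set g | forall U O, open_nbhs g U -> open_nbhs x O ->
     exists2 n : int, n != 0%R &
       O `&` (iterz T n @^-1` O) `&` [set y | U (cocycle n y)] !=set0].

Definition orbit_closure_range (x : X) : set G :=
  [set g | closure (skew_orbit (x, 1)) (x, g)].

Definition orbit_closure_eq (p q : X * G) : bool :=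
  `[< closure (skew_orbit p) = closure (skew_orbit q) >].

Let orbit_closure_eq_refl : reflexive orbit_closure_eq.
Proof. by move=> p; apply/asboolP. Qed.

Let orbit_closure_eq_sym : symmetric orbit_closure_eq.
Proof. by move=> p q; apply/asboolP/asboolP. Qed.

Let orbit_closure_eq_trans : transitive orbit_closure_eq.
Proof. by move=> q p r /asboolP pq /asboolP qr; apply/asboolP; rewrite pq. Qed.

Canonical orbit_closure_equiv :=
  EquivRel orbit_closure_eq
    orbit_closure_eq_refl orbit_closure_eq_sym orbit_closure_eq_trans.

Definition mackey_space := quotient_topology {eq_quot orbit_closure_equiv}.

Definition mackey_pi (p : X * G) : mackey_space := \pi_mackey_space p.

Definition translation (g : G) (p : X * G) : X * G := (p.1, p.2 * g^-1).

(* The representative chosen is irrelevant by mackey_actionE. *)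
Definition mackey_action (g : G) (w : mackey_space) : mackey_space :=
  mackey_pi (translation g (repr w)).

Definition mackey_stabilizer (w : mackey_space) : set G :=
  [set g | mackey_action g w = w].

Lemma mackey_piP p q :
  mackey_pi p = mackey_pi q <->
  closure (skew_orbit p) = closure (skew_orbit q).
Proof.
split=> [/eqmodP/asboolP//|pq]; exact/eqmodP/asboolP.
Qed.

Lemma skew_product_translation n g p :
  skew_product n (translation g p) = translation g (skew_product n p).
Proof. by rewrite /skew_product /translation /= mulgA. Qed.

Lemma translation_continuous g : continuous (translation g).
Proof.
move=> p; apply: cvg_pair; first exact: cvg_fst.
apply: (@continuous_comp _ _ _ (fun q : X * G => (q.2, g^-1))
  (fun q : G * G => q.1 * q.2)); last exact: mulg_continuous.
by apply: cvg_pair; [exact: cvg_snd|exact: cvg_cst].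
Qed.

Lemma translationK g : cancel (translation g) (translation g^-1).
Proof. by case=> x h; rewrite /translation/= invgK -mulgA mulVg mulg1. Qed.

Lemma closure_skew_orbit_translation g p q :
  closure (skew_orbit p) q ->
  closure (skew_orbit (translation g p)) (translation g q).
Proof.
move=> pq B /(@translation_continuous g) /pq [_ [[n _ <-] Bn]].
by exists (translation g (skew_product n p)); split=> //; exists n;
  rewrite ?skew_product_translation.
Qed.

Lemma mackey_actionE g p :
  mackey_action g (mackey_pi p) = mackey_pi (translation g p).
Proof.
rewrite /mackey_action; have : mackey_pi (repr (mackey_pi p)) = mackey_pi p.
  exact: reprK.
move: (repr _) => q /mackey_piP qp; apply/mackey_piP.
have sub a b : closure (skew_orbit a) = closure (skew_orbit b) ->
    closure (skew_orbit (translation g a)) `<=`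
    closure (skew_orbit (translation g b)).
  move=> ab r /(@closure_skew_orbit_translation g^-1); rewrite translationK ab.
  move=> /(@closure_skew_orbit_translation g).
  by rewrite -{2}(invgK g) translationK.
by apply/seteqP; split; apply: sub.
Qed.

End Cocycle.

(* Main.v *)
Require Import Defs.
From mathcomp Require Import all_boot all_order all_algebra.
From mathcomp Require Import all_classical all_reals all_analysis.
From mathcomp Require Import borel_hierarchy.

(** Recurrence puts the identity in every E_x, and every other point of P_x is
    approached along nonzero times because G is Hausdorff; so P_x is contained
    in E_x for all x.  Conversely, if g is in E_x, U is a neighborhood of g and
    O one of x, then x lies in the closure of the open set A(O,U) of points of O
    which return to O at some nonzero time with cocycle value in U.  Letting O
    and U range over countable bases, Baire's theorem makes the points whose
    orbit avoids all the boundaries of the A(O,U) a dense G_delta set, and there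
    E_x is contained in P_x.  Finally the stabilizer of phi(x,e) consists of the
    g such that both g and g^-1 belong to P_x, and E_x is always closed under
    inversion, as a return from y to T^n y with value f(n,y) is also a return
    from T^n y to y with value f(n,y)^-1. *)

Import Order.TTheory GRing.Theory Num.Theory.

Local Open Scope classical_set_scope.

(** * Baire's theorem in a complete metric space *)

Section CompleteMetric.
Context {R : realType}.

Lemma nbhs_mdist_le (M : metricType R) (x : M) (A : set M) : nbhs x A ->
  exists2 r : R, (0 < r)%R & forall y, (mdist x y <= r)%R -> A y.
Proof.
rewrite -metricType_numDomainType.filter_from_mdist_nbhs => -[e /= e0 xeA].
exists (e / 2)%R => [|y xy]; first by rewrite divr_gt0.
by apply: xeA; apply: le_lt_trans xy _; rewrite ltr_pdivrMr// ltr_pMr// ltr1n.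
Qed.

Lemma near_mdist_lt (M : metricType R) (x : M) (r : R) :
  (0 < r)%R -> nbhs x [set y | (mdist x y < r)%R].
Proof.
move=> r0.
by rewrite -metricType_numDomainType.filter_from_mdist_nbhs; exists r.
Qed.

(** Nested closed balls: the ball of index n + 1 lies in [F n] and in the ball of index n, and the
    radii tend to 0. The centres are then Cauchy, and their limit lies in every ball. *)
Lemma complete_metric_baire (M : metricType R) (S : set M) :
  complete_metric M -> Gdelta_dense S -> dense S.
Proof.
move=> M_complete [F F_dense ->] D [x0 Dx0] D_open.
(* A pair stands for a centre and a radius. Guarding by [0 < t.2] makes the relation total, so that
   choice applies; a nonpositive radius gets a dummy successor. *)
pose next n (s t : M * R) := (0 < t.2)%R ->
  [/\ (0 < s.2)%R, (s.2 <= n.+1%:R^-1)%R &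
  forall y, (mdist s.1 y <= s.2)%R -> F n y /\ (mdist t.1 y <= t.2)%R].
have next_ex (a : nat * (M * R)) : exists s, next a.1 s a.2.
  case: a => n [x r]; have [/= r0|r_le0] := ltP 0%R r; last first.
    by exists (x, r) => /= r0; move: (lt_le_trans r0 r_le0); rewrite ltxx.
  have [F_open F_dn] := F_dense n.
  have [z [xz Fz]] : (interior [set y | (mdist x y < r)%R] `&` F n) !=set0.
    by apply: F_dn; [exists x; exact: near_mdist_lt|exact: open_interior].
  have /nbhs_mdist_le[e e0 zeP] : nbhs z ([set y | (mdist x y < r)%R] `&` F n).
    by apply: filterI; [exact: xz|exact: open_nbhs_nbhs].
  exists (z, Num.min e n.+1%:R^-1)%R => _; split => /=.
  - by rewrite lt_min e0 invr_gt0 ltr0n.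
  - by rewrite ge_min lexx orbT.
  - by move=> y; rewrite le_min => /andP[/zeP[/ltW xy Fy] _].
have [g gP] := choice next_ex.
have /nbhs_mdist_le[r0 r0_gt0 x0D] : nbhs x0 D by exact: open_nbhs_nbhs.
pose fix s n := if n is k.+1 then g (k, s k) else (x0, r0).
have s_gt0 n : (0 < (s n).2)%R.
  by elim: n => //= n sn0; have [] := gP (n, s n) sn0.
have s_le n : ((s n.+1).2 <= n.+1%:R^-1)%R by have [] := gP (n, s n) (s_gt0 n).
have sF n y : (mdist (s n.+1).1 y <= (s n.+1).2)%R ->
    F n y /\ (mdist (s n).1 y <= (s n).2)%R.
  by have [_ _] := gP (n, s n) (s_gt0 n); exact.
have s_nested n k y : (mdist (s (k + n)%N).1 y <= (s (k + n)%N).2)%R ->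
    (mdist (s n).1 y <= (s n).2)%R.
  by elim: k => // k IH /sF[_ /IH].
have s_near n m : (n <= m)%N -> (mdist (s n).1 (s m).1 <= (s n).2)%R.
  move=> /subnK nm; apply: (@s_nested n (m - n)%N).
  by rewrite nm mdistxx ltW.
have [l sl] : exists l : M, (fun n => (s n).1) @ \oo --> l.
  apply: M_complete; apply/cauchyP => e e0.
  (* The index is n + 1 because the bound 1 / (n + 1) holds for the ball [s n.+1]; the initial
     radius [r0] is arbitrary. *)
  near \oo => n; exists (s n.+1).1; exists n.+1 => // m /= nm.
  rewrite /fmap/= ballEmdist/=; apply: le_lt_trans (s_near _ _ nm) _.
  apply: le_lt_trans (s_le n) _; near: n.
  exact: near_infty_natSinv_lt (PosNum e0).
have l_in n : (mdist (s n).1 l <= (s n).2)%R.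
  apply/ler_addgt0Pr => e e0; near \oo => m.
  apply: le_trans (metric_triangle (s n).1 (s m).1 l) _; apply: lerD.
    by apply: s_near; near: m; exact: nbhs_infty_ge.
  rewrite metric_sym ltW//; near: m.
  exact: (metricType_numDomainType.cvgr_dist_lt sl).
exists l; split; first exact/x0D/(l_in 0%N).
by move=> n _; have [] := sF n l (l_in n.+1).
Unshelve. all: by end_near. Qed.

End CompleteMetric.

(** * Transport along homeomorphisms *)

Definition homeo_sym {X Y : topologicalType} (h : homeomorphism X Y) :
    homeomorphism Y X :=
  Homeomorphism (homeo_invK h) (homeo_funK h)
    (@homeo_inv_continuous _ _ h) (@homeo_fun_continuous _ _ h).

Lemma homeo_inj {X Y : topologicalType} (h : homeomorphism X Y) : injective h.
Proof. exact: can_inj (homeo_funK h). Qed.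

Lemma homeo_dense_preimage {X Y : topologicalType} (h : homeomorphism X Y)
  (S : set Y) : dense S -> dense (h @^-1` S).
Proof.
move=> S_dense O [x Ox] O_open.
have [||y [Oy Sy]] := S_dense (homeo_inv h @^-1` O).
- by exists (h x); rewrite /preimage/= homeo_funK.
- by move/continuousP : (@homeo_inv_continuous _ _ h); exact.
- by exists (homeo_inv h y); split => //; rewrite /preimage/= homeo_invK.
Qed.

Lemma homeo_open_preimage {X Y : topologicalType} (h : homeomorphism X Y)
  (S : set Y) : open S -> open (h @^-1` S).
Proof. by move/continuousP : (@homeo_fun_continuous _ _ h); exact. Qed.

(** * Baire, Hausdorff and countable base properties of Polish spaces *)

Section Polish.
Context {R : realType} {X : topologicalType}.

Lemma completely_metrizable_baire (S : set X) :
  completely_metrizable R X -> Gdelta_dense S -> dense S.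
Proof.
move=> [M M_complete [h]] [F F_dense ->].
rewrite (_ : \bigcap_i F i = h @^-1` (\bigcap_i (homeo_sym h @^-1` F i))).
  apply/homeo_dense_preimage/(complete_metric_baire _ _ M_complete).
  eexists; last by []. move=> i; have [F_open F_dn] := F_dense i; split.
  - exact: homeo_open_preimage.
  - exact: homeo_dense_preimage.
by rewrite preimage_bigcap; apply: eq_bigcapr => i _;
  apply/seteqP; split => x; rewrite /preimage/= homeo_funK.
Qed.

Lemma completely_metrizable_hausdorff :
  completely_metrizable R X -> hausdorff_space X.
Proof.
move=> [M _ [h]] x y xy; apply: (@homeo_inj _ _ h).
apply: metric_hausdorff => A B hxA hyB.
have [z [Az Bz]] := xy _ _ (@homeo_fun_continuous _ _ h x A hxA)
  (@homeo_fun_continuous _ _ h y B hyB).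
by exists (h z).
Qed.

Lemma polish_second_countable : polish R X -> @second_countable X.
Proof.
move=> [[D D_countable D_dense] [M _ [h]]].
pose B (a : X * nat) : set X := h @^-1` (ball (h a.1) (a.2.+1%:R^-1)%R)°.
exists (B @` (D `*` [set: nat])).
  apply: sub_countable (card_image_le _ _) _.
  by apply: countableX => //; exact: countableP.
split=> [_ [a _ <-]|x V]; first exact/homeo_open_preimage/open_interior.
rewrite -{1}(homeo_funK h x) => /homeo_inv_continuous/nbhs_ballP[e /= e0 eV].
(* With 1 / (n + 1) at most e / 2 and d within half of 1 / (n + 1) of x, the ball of radius 1 / (n +
   1) at d has x in its interior and stays within e of x. *)
near \oo => n.
have n0 : (0 < n.+1%:R^-1 / 2 :> R)%R by rewrite divr_gt0 ?invr_gt0.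
have [||d [xd Dd]] := D_dense (h @^-1` (ball (h x) (n.+1%:R^-1 / 2)%R)°).
- by exists x; exact: nbhsx_ballx.
- exact/homeo_open_preimage/open_interior.
exists (B (d, n)); first split.
- by exists (d, n).
- rewrite /B /preimage /interior /=; apply/nbhs_ballP.
  exists (n.+1%:R^-1 / 2)%R => //= y xy.
  rewrite (splitr (n.+1%:R^-1)%R); apply: ball_triangle _ xy.
  exact/ball_sym/(interior_subset xd).
- move=> y dy; rewrite -(homeo_funK h y); apply: eV.
  rewrite (splitr e); have ne : (n.+1%:R^-1 <= e / 2)%R.
    apply/ltW; near: n; apply: near_infty_natSinv_lt (PosNum _).
    by rewrite divr_gt0.
  apply: (@ball_triangle _ _ (h d)); apply: (le_ball ne).
    apply: (@le_ball _ _ _ (n.+1%:R^-1 / 2)%R); last exact: interior_subset xd.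
    by rewrite ler_pdivrMr// ler_pMr ?invr_gt0// ler1n.
  exact: interior_subset dy.
Unshelve. all: by end_near. Qed.

End Polish.

(** * Countable intersections of dense open sets *)

Section Genericity.
Context {X : topologicalType}.

Lemma countable_bigcap_Gdelta_dense (C : set (set X)) : countable C ->
  (forall A, C A -> open A /\ dense A) -> Gdelta_dense (\bigcap_(A in C) A).
Proof.
move=> /pfcard_geP[->|[g]] C_dense.
  (* The empty family has no enumeration; a constant sequence of full sets has the same
     intersection. *)
  exists (fun=> setT) => [_|]; last by rewrite bigcap_set0 bigcap_const.
  by split=> [|O O0 _]; [exact: openT|rewrite setIT].
exists g => [n|]; first exact/C_dense/funS.
by rewrite -[in LHS](image_eq g) bigcap_image.
Qed.

(** The union omits exactly the boundary of A, which is nowhere dense since A is open. *)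
Lemma open_or_exterior_dense (A : set X) :
  open A -> open (A `|` ~` closure A) /\ dense (A `|` ~` closure A).
Proof.
move=> A_open; split.
  by apply: openU => //; rewrite openC; exact: closed_closure.
move=> O [x Ox] O_open; have [xA|xA] := pselect (closure A x).
  have [|y [Ay Oy]] := xA O; first exact: open_nbhs_nbhs.
  by exists y; split=> //; left.
by exists x; split=> //; right.
Qed.

End Genericity.

(** * Integer iterates of a homeomorphism *)

Section Iterates.
Context {X : topologicalType} (T : homeomorphism X X).

Lemma iterzS n x : iterz T (n + 1)%R x = T (iterz T n x).
Proof.
case: n => [n|[|n]]; first by rewrite -PoszD addn1.
  by rewrite /= homeo_invK.
have -> : (Negz n.+1 + 1)%R = Negz n by rewrite !NegzE -addn1 PoszD opprD subrK.
exact/esym/homeo_invK.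
Qed.

Lemma iterzB1 n x : iterz T (n - 1)%R x = homeo_inv T (iterz T n x).
Proof. by rewrite -{2}(subrK 1%R n) iterzS homeo_funK. Qed.

Lemma iterzD m n x : iterz T (m + n)%R x = iterz T m (iterz T n x).
Proof.
elim/int_rect: m => [|m IH|m IH]; first by rewrite add0r.
  by rewrite -addn1 PoszD [(_ + 1 + _)%R]addrAC !iterzS IH.
by rewrite -addn1 PoszD opprD [(_ - 1 + _)%R]addrAC !iterzB1 IH.
Qed.

Lemma iterzK n : cancel (iterz T n) (iterz T (- n)%R).
Proof. by move=> x; rewrite -iterzD addNr. Qed.

Lemma iterzNK n : cancel (iterz T (- n)%R) (iterz T n).
Proof. by move=> x; rewrite -iterzD subrr. Qed.

Lemma iterz_continuous n : continuous (iterz T n).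
Proof.
elim/int_rect: n => [|n IH|n IH]; first by move=> x; exact: cvg_id.
  rewrite (_ : iterz T _ = T \o iterz T n).
    move=> x; apply: continuous_comp; first exact: IH.
    exact: homeo_fun_continuous.
  by apply/funext => x; rewrite -addn1 PoszD iterzS.
rewrite (_ : iterz T _ = homeo_inv T \o iterz T (- n%:Z)%R).
  by move=> x; apply: continuous_comp; [exact: IH|exact: homeo_inv_continuous].
by apply/funext => x; rewrite -addn1 PoszD opprD iterzB1.
Qed.

Definition iterz_homeo n : homeomorphism X X :=
  Homeomorphism (iterzK n) (iterzNK n)
    (iterz_continuous n) (iterz_continuous (- n)%R).

(** Applying T only shifts the times n by one, and n runs over all integers. This gives the
    invariance of the generic set. *)
Lemma image_bigcap_iterz (F : set X) :
  T @` (\bigcap_n (iterz T n @^-1` F)) = \bigcap_n (iterz T n @^-1` F).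
Proof.
apply/seteqP; split => [_ [x xF <-] n _|x xF].
  by have := xF (n + 1)%R I; rewrite /preimage/= iterzD.
exists (homeo_inv T x); last exact: homeo_invK.
by move=> n _; have := xF (n - 1)%R I; rewrite /preimage/= iterzD.
Qed.

End Iterates.

(** * The skew product as a homeomorphism, and the cocycle identities *)

Section SkewProduct.
Context {X : topologicalType} {G : topologicalGroupType}.
Context (T : homeomorphism X X) (f : X -> G) (f_continuous : continuous f).

Lemma mulg_fun_continuous (Y : topologicalType) (u v : Y -> G) :
  continuous u -> continuous v -> continuous (fun y => u y * v y)%g.
Proof.
move=> u_cont v_cont y.
apply: (@continuous_comp _ _ _ (fun y => (u y, v y))
  (fun q : G * G => q.1 * q.2)%g); last exact: mulg_continuous.
by apply: cvg_pair; [exact: u_cont|exact: v_cont].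
Qed.

Let skew (p : X * G) := (T p.1, f p.1 * p.2)%g.
Let skew_inv (p : X * G) :=
  (homeo_inv T p.1, (f (homeo_inv T p.1))^-1 * p.2)%g.

Let skewK : cancel skew skew_inv.
Proof. by case=> x g; rewrite /skew_inv /= homeo_funK mulgA mulVg mul1g. Qed.

Let skew_invK : cancel skew_inv skew.
Proof. by case=> x g; rewrite /skew /= homeo_invK mulgA mulgV mul1g. Qed.

Let skew_continuous : continuous skew.
Proof.
move=> p; apply: cvg_pair.
  by apply: continuous_comp; [exact: cvg_fst|exact: homeo_fun_continuous].
apply: mulg_fun_continuous => q; last exact: cvg_snd.
by apply: continuous_comp; [exact: cvg_fst|exact: f_continuous].
Qed.

Let skew_inv_continuous : continuous skew_inv.
Proof.
have inv1 : continuous (fun p : X * G => homeo_inv T p.1).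
  move=> p; apply: continuous_comp; first exact: cvg_fst.
  exact: homeo_inv_continuous.
move=> p; apply: cvg_pair; first exact: inv1.
apply: (@mulg_fun_continuous _ (fun q => (f (homeo_inv T q.1))^-1)%g snd) => q;
  last exact: cvg_snd.
apply: (@continuous_comp _ _ _ (fun q : X * G => f (homeo_inv T q.1)));
  last exact: invg_continuous.
by apply: continuous_comp; [exact: inv1|exact: f_continuous].
Qed.

Definition skew_homeo : homeomorphism (X * G)%type (X * G)%type :=
  Homeomorphism skewK skew_invK skew_continuous skew_inv_continuous.

(** Once the skew product is the iteration of its time-one map, its group law and continuity, and
    from these the properties of the cocycle, follow from those of [iterz]. *)
Lemma skew_productE n : skew_product T f n = iterz skew_homeo n.
Proof.
have natE k p : skew_product T f (Posz k) p = iter k skew_homeo p.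
  elim: k => [|k IH]; first by case: p => x g; rewrite /skew_product /= mul1g.
  by rewrite iterS -IH /= /skew /= mulgA.
apply/funext => p; case: n => k; first exact: natE.
(* For the time -(k + 1), it suffices that k + 1 forward steps bring the left side back to p. *)
rewrite -[LHS](iterzK skew_homeo (Posz k.+1)) [iterz _ k.+1 _]/= -iterS -natE.
rewrite /skew_product (_ : iterz T k.+1 _ = p.1); last first.
  exact: (iterzNK T (Posz k.+1)).
by rewrite /= mulgA mulgV mul1g; case: p.
Qed.

Lemma skew_productD m n p :
  skew_product T f (m + n)%R p = skew_product T f m (skew_product T f n p).
Proof. by rewrite !skew_productE iterzD. Qed.

Lemma skew_product_continuous n : continuous (skew_product T f n).
Proof. by rewrite skew_productE; exact: iterz_continuous. Qed.

Lemma cocycle_continuous n : continuous (cocycle T f n).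
Proof.
move=> x.
rewrite (_ : cocycle T f n = fun y => (skew_product T f n (y, 1%g)).2).
  apply: (@continuous_comp _ _ _ (fun y => skew_product T f n (y, 1%g)));
    last exact: cvg_snd.
  apply: (@continuous_comp _ _ _ (fun y => (y, 1%g)));
    last exact: skew_product_continuous.
  by apply: cvg_pair; [exact: cvg_id|exact: cvg_cst].
by apply/funext => y; rewrite /= mulg1.
Qed.

(** Compare second coordinates after going from (x, 1) by n and then by -n. *)
Lemma cocycleN n x :
  cocycle T f (- n)%R (iterz T n x) = ((cocycle T f n x)^-1)%g.
Proof.
have /(congr1 snd) := skew_productD (- n)%R n (x, 1%g).
rewrite addNr /= !mulg1 => ncn.
by rewrite -[LHS]mulg1 -(mulgV (cocycle T f n x)) mulgA -ncn mul1g.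
Qed.

(** * Orbit closures, recurrence and the local essential range *)

Lemma closure_skew_orbit_sub p q : closure (skew_orbit T f p) q ->
  closure (skew_orbit T f q) `<=` closure (skew_orbit T f p).
Proof.
move=> pq r qr B /nbhs_interior/qr[_ [[n _ <-] /skew_product_continuous/pq]].
by move=> [_ [[m _ <-] Bmn]]; exists (skew_product T f (n + m)%R p);
  split; [exists (n + m)%R|rewrite skew_productD].
Qed.

(** Brings P_x into the shape of E_x: here the returning point is x itself, and n = 0 is allowed. *)
Lemma orbit_closure_rangeP x g : orbit_closure_range T f x g <->
  forall U O, nbhs g U -> nbhs x O ->
    exists n, O (iterz T n x) /\ U (cocycle T f n x).
Proof.
split=> [xg U O gU xO|xg B].
  have [|_ [[n _ <-] [/= On Un]]] := xg (O `*` U); first by exists (O, U).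
  by exists n; rewrite -[cocycle _ _ _ _]mulg1.
case=> -[V U] /= [xV gU] VUB.
have [n [On Un]] := xg _ _ gU xV.
exists (skew_product T f n (x, 1%g)); split; first by exists n.
by apply: VUB; rewrite /skew_product /= mulg1.
Qed.

Lemma local_essential_range1 x :
  recurrent T f -> local_essential_range T f x 1%g.
Proof.
move=> f_recurrent U O [U_open U1] [oO Ox].
have : nbhs (1%g, 1%g) (fun q : G * G => U (q.1 * q.2^-1)%g).
  have divg_cont : continuous (fun q : G * G => (q.1 * q.2^-1)%g).
    apply: mulg_fun_continuous => q; first exact: cvg_fst.
    apply: (@continuous_comp _ _ _ snd); first exact: cvg_snd.
    exact: invg_continuous.
  by apply: (divg_cont (1%g, 1%g)); rewrite /= mulgV; exact: open_nbhs_nbhs.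
case=> -[V1 V2] /= [V1n V2n] VU.
(* If (y, h) and its image at time n both lie in O x V, then f(n, y) = (f(n, y) h) h^-1 lies in V
   V^-1, hence in U. *)
pose V := (V1 `&` V2)°.
have V_in h : V h -> V1 h /\ V2 h by move=> /interior_subset.
have V1g : V 1%g by apply: filterI.
have [||n n0 [_ [[[y h] [/= Oy Vh] <-] [/= Ony Vnh]]]] := f_recurrent (O `*` V).
- rewrite openE => -[y h] [/= Oy Vh]; exists (O, V) => //.
  by split; apply: open_nbhs_nbhs; split=> //; exact: open_interior.
- by exists (x, 1%g).
exists n => //; exists y; split => //=.
have /(_ ((cocycle T f n y * h)%g, h)) := VU.
rewrite /= -mulgA mulgV mulg1; apply; split => /=.
  by have [] := V_in _ Vnh.
by have [] := V_in _ Vh.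
Qed.

Lemma local_essential_rangeV x g :
  local_essential_range T f x g -> local_essential_range T f x (g^-1)%g.
Proof.
move=> xg U O [U_open Ug] xO.
have [|n n0 [y [[Oy Ony] Uny]]] := xg [set h | U (h^-1)%g] O _ xO.
  split=> //; move/continuousP : (@invg_continuous G); exact.
exists (- n)%R; first by rewrite oppr_eq0.
exists (iterz T n y); split; last by rewrite /= cocycleN.
by split=> //; rewrite /preimage/= iterzK.
Qed.

Lemma orbit_closure_range_sub x : hausdorff_space G -> recurrent T f ->
  orbit_closure_range T f x `<=` local_essential_range T f x.
Proof.
move=> G_hausdorff f_recurrent g xg.
have [->|g1] := pselect (g = 1%g); first exact: local_essential_range1.
move=> U O [U_open Ug] [oO Ox].
(* Removing 1 from U excludes the time 0, where the cocycle equals 1. *)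
have U'n : nbhs g (U `\ 1%g).
  apply: open_nbhs_nbhs; split; last by split.
  apply: openI => //; rewrite openC.
  exact/accessible_closed_set1/hausdorff_accessible.
have [n [On [Un n1]]] := (orbit_closure_rangeP x g).1 xg _ _ U'n
  (open_nbhs_nbhs (conj oO Ox)).
by exists n; [apply/eqP => n0; apply: n1; rewrite n0|exists x].
Qed.

(** * The open return sets A(O,U) and the generic inclusion of E_x in P_x *)

Definition return_set (O : set X) (U : set G) : set X :=
  O `&` \bigcup_(n in [set n : int | n != 0%R])
    (iterz T n @^-1` O `&` cocycle T f n @^-1` U).

Lemma return_set_open O U : open O -> open U -> open (return_set O U).
Proof.
move=> O_open U_open; apply: openI => //; apply: bigcup_open => n _.
apply: openI; first by move/continuousP : (iterz_continuous T n); exact.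
by move/continuousP : (cocycle_continuous n); exact.
Qed.

Lemma local_essential_range_closure x g O U :
  local_essential_range T f x g -> open_nbhs g U -> open_nbhs x O ->
  closure (return_set O U) x.
Proof.
move=> xg gU xO B xB.
(* Shrinking O by the interior of B forces the returning point into B. *)
have [|n n0 [y [[[Oy By] [Ony _]] Uny]]] := xg U (O `&` B°) gU.
  by apply: open_nbhsI => //; split; [exact: open_interior|].
by exists y; split; [split=> //; exists n|exact: interior_subset].
Qed.

Lemma generic_orbit_closure_range :
  @second_countable X -> @second_countable G ->
  exists X0 : set X, [/\ T @` X0 = X0, Gdelta_dense X0 &
    forall x, X0 x ->
      local_essential_range T f x `<=` orbit_closure_range T f x].
Proof.
move=> [BX BX_countable [BX_open BX_nbhs]] [BG BG_countable [BG_open BG_nbhs]].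
pose off_boundary (a : set X * set G) :=
  return_set a.1 a.2 `|` ~` closure (return_set a.1 a.2).
(* Pulling back by all integer times keeps the family countable and makes its intersection
   invariant. *)
pose C := (fun a => iterz T a.1 @^-1` off_boundary a.2) @`
  ([set: int] `*` (BX `*` BG)).
have CE : \bigcap_(A in C) A =
    \bigcap_n (iterz T n @^-1` (\bigcap_(a in BX `*` BG) off_boundary a)).
  rewrite bigcap_image; apply/seteqP.
  split => [x xC n _ a aB|x xC [n a] [_ aB]].
    exact: (xC (n, a)).
  exact: xC.
exists (\bigcap_(A in C) A); split.
- by rewrite CE image_bigcap_iterz.
- apply: countable_bigcap_Gdelta_dense.
    apply: sub_countable (card_image_le _ _) _.
    by apply: countableX; [exact: countableP|exact: countableX].
  move=> _ [[n [V U]] [_ [/= BV BU]] <-].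
  have [A_open A_dense] :=
    open_or_exterior_dense _
      (return_set_open _ _ (BX_open _ BV) (BG_open _ BU)).
  split; first exact: (homeo_open_preimage (iterz_homeo T n)).
  exact: (homeo_dense_preimage (iterz_homeo T n)).
- rewrite CE => x x_generic g xg; apply/orbit_closure_rangeP => U O.
  move=> /BG_nbhs[U' [BU' U'g] U'U] /BX_nbhs[V [BV Vx] VO].
  (* Since x avoids the boundary of A(V,U') but lies in its closure, x itself returns. *)
  have [[_ [n n0 [On Un]]]|] := x_generic 0%R I (V, U') (conj BV BU').
    by exists n; split; [exact: VO|exact: U'U].
  case; apply: local_essential_range_closure xg _ _.
    by split=> //; exact: BG_open.
  by split=> //; exact: BX_open.
Qed.

(** * The stabilizer under the Mackey action *)

Lemma mackey_stabilizerP x g : mackey_stabilizer (mackey_pi T f (x, 1%g)) g <->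
  orbit_closure_range T f x g /\ orbit_closure_range T f x (g^-1)%g.
Proof.
(* The claim becomes equality of the orbit closures of (x, g^-1) and (x, 1). One inclusion says that
   g^-1 is in P_x; the other, after right multiplication by g, that g is. *)
rewrite /mackey_stabilizer /= mackey_actionE mackey_piP.
rewrite /translation /= mul1g.
have self p : closure (skew_orbit T f p) p.
  apply: subset_closure; exists 0%R => //.
  by rewrite /skew_product /= mul1g; case: p.
have translated h k : closure (skew_orbit T f (x, h)) (x, k) ->
    closure (skew_orbit T f (x, h * g)%g) (x, k * g)%g.
  move/(@closure_skew_orbit_translation _ _ T f (g^-1)%g).
  by rewrite /translation /= invgK.
split=> [gE|[xg xgV]].
  split; last by rewrite /orbit_closure_range /= -gE.
  have := self (x, 1%g); rewrite -{1}gE => /translated.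
  by rewrite mulVg mul1g.
apply/seteqP; split; first exact: closure_skew_orbit_sub.
apply: closure_skew_orbit_sub.
have := @closure_skew_orbit_translation _ _ T f g _ _ xg.
by rewrite /translation /= mul1g mulgV.
Qed.

End SkewProduct.

Theorem proposition2p2 (R : realType)
    (X : topologicalType) (X_polish : polish R X)
    (X_perfect : perfect_set [set: X])
    (T : homeomorphism X X) (T_minimal : minimal T)
    (G : topologicalGroupType) (G_polish : polish R G)
    (f : X -> G) (f_continuous : continuous f) (f_recurrent : recurrent T f) :
  exists X0 : set X,
    [/\ T @` X0 = X0, dense X0, Gdelta X0 &
      forall x, X0 x ->
        local_essential_range T f x = orbit_closure_range T f x /\
        orbit_closure_range T f x =
          mackey_stabilizer (mackey_pi T f (x, 1%g))].
Proof.
have [X0 [X0_inv X0_Gdelta X0_sub]] :=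
  generic_orbit_closure_range T _ f_continuous
    (polish_second_countable X_polish) (polish_second_countable G_polish).
exists X0; split=> //.
- exact: completely_metrizable_baire (proj2 X_polish) X0_Gdelta.
- by have [F F_od ->] := X0_Gdelta; exists F => // i; have [] := F_od i.
move=> x /X0_sub ess_sub.
have essE : local_essential_range T f x = orbit_closure_range T f x.
  apply/seteqP; split=> //; apply: orbit_closure_range_sub => //.
  exact: completely_metrizable_hausdorff (proj2 G_polish).
split=> //; apply/seteqP; split=> g.
  (* Here P_x equals E_x and so inherits closure under inversion. *)
  move=> xg; apply/(mackey_stabilizerP T _ f_continuous); split=> //.
  by move: xg; rewrite -essE; exact: local_essential_rangeV.
by move/(mackey_stabilizerP T _ f_continuous) => [].
Qed.
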